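(* For every integer $n\ge 1$, the graph $G_n$ is not polytopal, where $G_n$ is the graph with vertex set $\mathbb{Z}_{2n+3}\times\mathbb{Z}_2$ in which the vertex $(x,y)$, with $y\in\{0,1\}$, is adjacent to the vertices $(x+y+1,y)$, $(x+y,y+1)$, $(x-y-1,y)$ and $(x+y-1,y+1)$.
   Context: First coordinates are taken modulo $2n+3$ and second coordinates modulo $2$; in sums such as $x+y+1$ in the first coordinate, $y$ is read as the integer $0$ or $1$. Explicitly, $(x,0)$ is adjacent to $(x+1,0),(x-1,0),(x,1),(x-1,1)$, and $(x,1)$ is adjacent to $(x+2,1),(x-2,1),(x+1,0),(x,0)$. A graph is polytopal if it is isomorphic to the graph (vertices and edges) of some polytope, of any dimension. *)

(* Defs.v *)
From mathcomp Require Import all_boot all_order all_algebra.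
From mathcomp Require Import all_classical all_reals.

Set Implicit Arguments.
Unset Strict Implicit.
Unset Printing Implicit Defensive.

Import Order.TTheory GRing.Theory Num.Theory.

Local Open Scope classical_set_scope.
Local Open Scope ring_scope.

Section Polytopes.
Variables (R : realType) (d : nat).
Implicit Types (P F : set 'rV[R]_d) (u v : 'rV[R]_d).

Definition conv_hull (m : nat) (p : 'I_m -> 'rV[R]_d) : set 'rV[R]_d :=
  [set x | exists w : 'I_m -> R,
     [/\ forall i, 0 <= w i, \sum_i w i = 1 & x = \sum_i w i *: p i]].

Definition is_polytope P :=
  exists (m : nat) (p : 'I_m -> 'rV[R]_d), P = conv_hull p.

(* The column [c] encodes the linear functional [x |-> (x *m c) 0 0].  The
   valid inequalities [0 <= 0] and [0 <= 1] make [P] and [set0] faces of [P]. *)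
Definition is_face P F :=
  exists (c : 'cV[R]_d) (b : R),
    (forall x, P x -> (x *m c) 0 0 <= b) /\
    F = [set x | P x /\ (x *m c) 0 0 = b].

Definition segment u v : set 'rV[R]_d :=
  [set x | exists t : R, 0 <= t <= 1 /\ x = (1 - t) *: u + t *: v].

Definition is_vertex P v := is_face P [set v].

Definition is_edge P u v :=
  [/\ is_vertex P u, is_vertex P v, u <> v & is_face P (segment u v)].

End Polytopes.

Definition polytopal (R : realType) (T : finType) (e : rel T) :=
  exists (d : nat) (P : set 'rV[R]_d) (f : T -> 'rV[R]_d),
    [/\ is_polytope P,
        injective f,
        range f = is_vertex P
      & forall x y : T, e x y <-> is_edge P (f x) (f y)].

(* The modulus is written in the form [_.+3] so that ['Z_(n.*2.+3)] is
   convertible to ['I_(n.*2.+3)]. *)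
Definition G_vertex (n : nat) : finType := ('Z_(n.*2.+3) * 'Z_2)%type.

Definition G (n : nat) : rel (G_vertex n) := fun a b =>
  let: (x, y) := a in
  let y' : 'Z_(n.*2.+3) := (y : nat)%:R in
  b \in [:: (x + y' + 1, y); (x + y', y + 1);
            (x - y' - 1, y); (x + y' - 1, y + 1)].

Arguments G n : clear implicits.

(* Main.v *)
Require Import Defs.
From mathcomp Require Import all_boot all_order all_algebra.
From mathcomp Require Import all_classical all_reals.
From mathcomp Require Import ring lra.

Set Implicit Arguments.
Unset Strict Implicit.
Unset Printing Implicit Defensive.

Import Order.TTheory GRing.Theory Num.Theory.

Local Open Scope ring_scope.

(** The graph is 4-regular, and seen from a vertex a polytope lies in the cone
    spanned by the edges at that vertex ([nb_cone]).  At the origin, the four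
    edge directions are therefore either dependent, and the polytope has
    dimension at most 3, or independent, and it is a simple 4-polytope.

    In the dependent case the four neighbours of the origin are seen as the
    corners of a quadrilateral.  Two paths that avoid the origin, one between
    two opposite corners and one between the other two, have to meet
    ([no_disjoint_paths]): central projection from the origin draws them in the
    quadrilateral, and drawings of disjoint paths are disjoint.  There are three
    ways to split the four corners into two pairs.  Each of them is excluded by
    two cycles that share the origin only: two triangles, two 4-cycles, or the
    cycle of all [(x, 0)] together with a path through vertices [(x, 1)].

    In the independent case the polytope is simple at every vertex
    ([simple_everywhere]).  A 4-cycle without chords bounds a 2-face there, so a
    facet that contains three corners of such a cycle contains the fourth
    ([facet_square]).  Consider the facet that contains the origin, [(1, 0)],
    [(-1, 0)] and [(0, 1)] but not [(-1, 1)].  It contains all the vertices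
    [(x, 0)], and for each [x] exactly one of [(x, 1)] and [(x - 1, 1)].  The
    squares make these two possibilities alternate along the cycle of the
    [(x, 0)], which is absurd because this cycle has odd length [2n+3]. *)

(** * Linear functionals and finitely generated cones *)

Section Functionals.
Variables (R : realFieldType) (d : nat).
Implicit Types (c : 'cV[R]_d) (x y : 'rV[R]_d).

Definition ev c x : R := (x *m c) 0 0.

Lemma evD c x y : ev c (x + y) = ev c x + ev c y.
Proof. by rewrite /ev mulmxDl mxE. Qed.

Lemma evN c x : ev c (- x) = - ev c x.
Proof. by rewrite /ev mulNmx mxE. Qed.

Lemma evB c x y : ev c (x - y) = ev c x - ev c y.
Proof. by rewrite evD evN. Qed.

Lemma evZ c t x : ev c (t *: x) = t * ev c x.
Proof. by rewrite /ev -scalemxAl mxE. Qed.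

Lemma ev0 c : ev c 0 = 0.
Proof. by rewrite /ev mul0mx mxE. Qed.

Lemma ev_sum c (I : Type) (r : seq I) (Q : pred I) (F : I -> 'rV[R]_d) :
  ev c (\sum_(i <- r | Q i) F i) = \sum_(i <- r | Q i) ev c (F i).
Proof. by rewrite /ev mulmx_suml summxE. Qed.

Lemma evDl b c x : ev (b + c) x = ev b x + ev c x.
Proof. by rewrite /ev mulmxDr mxE. Qed.

Lemma evNl c x : ev (- c) x = - ev c x.
Proof. by rewrite /ev mulmxN mxE. Qed.

Lemma evBl b c x : ev (b - c) x = ev b x - ev c x.
Proof. by rewrite evDl evNl. Qed.

Lemma evZl t c x : ev (t *: c) x = t * ev c x.
Proof. by rewrite /ev -scalemxAr mxE. Qed.

End Functionals.

Section Cones.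
Variables (R : realFieldType) (d : nat) (I : finType).
Implicit Types (a : I -> 'rV[R]_d) (J : {set I}) (v : 'rV[R]_d).

Definition in_cone a J v :=
  exists t : I -> R, (forall i, 0 <= t i) /\ v = \sum_(i in J) t i *: a i.

Lemma in_cone0 a J : in_cone a J 0.
Proof.
by exists (fun=> 0); split=> //; rewrite big1 // => i _; rewrite scale0r.
Qed.

Lemma in_coneD a J v w : in_cone a J v -> in_cone a J w -> in_cone a J (v + w).
Proof.
move=> [s [s0 ->]] [t [t0 ->]]; exists (fun i => s i + t i); split.
  by move=> i; rewrite addr_ge0.
by rewrite -big_split; apply: eq_bigr => i _; rewrite scalerDl.
Qed.

Lemma in_coneZ a J s v : 0 <= s -> in_cone a J v -> in_cone a J (s *: v).
Proof.
move=> s0 [t [t0 ->]]; exists (fun i => s * t i); split.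
  by move=> i; rewrite mulr_ge0.
by rewrite scaler_sumr; apply: eq_bigr => i _; rewrite scalerA.
Qed.

Lemma in_cone_sum a J (K : finType) (Q : pred K) (s : K -> R)
    (F : K -> 'rV[R]_d) :
  (forall k, 0 <= s k) -> (forall k, Q k -> in_cone a J (F k)) ->
  in_cone a J (\sum_(k | Q k) s k *: F k).
Proof.
move=> s0 FJ; apply: (big_ind (in_cone a J)); first exact: in_cone0.
  exact: in_coneD.
by move=> k Qk; apply: in_coneZ => //; apply: FJ.
Qed.

Lemma in_cone_gen a J i : i \in J -> in_cone a J (a i).
Proof.
move=> iJ; exists (fun j => (j == i)%:R); split=> [j|]; first by rewrite ler0n.
rewrite (bigD1 i) //= eqxx scale1r big1 ?addr0 // => j /andP[_ /negPf ->].
by rewrite scale0r.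
Qed.

(** Induction on the number of generators, after Bartl: if the functional [x]
    found for all generators but [a k] is positive on [a k], projecting along
    [a k] onto the kernel of [x] disposes of [a k]. *)
Lemma farkas a J v :
  in_cone a J v \/
  exists c, (forall i, i \in J -> ev c (a i) <= 0) /\ 0 < ev c v.
Proof.
have [m] := ubnP #|J|; elim: m => // m IHm in a J v *.
have [->|[k kJ]] := set_0Vmem J => [_|].
  have [->|v0] := eqVneq v 0; first by left; apply: in_cone0.
  right; exists v^T; split=> [i|]; first by rewrite inE.
  have [j vj] : exists j, v 0 j != 0 by apply/rV0Pn.
  rewrite /ev mxE (bigD1 j) //= mxE ltr_pwDl ?sumr_ge0 //.
    by rewrite -expr2 exprn_even_gt0.
  by move=> i _; rewrite mxE -expr2 sqr_ge0.
rewrite (cardsD1 k) kJ ltnS add1n => ltJ.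
have [vJ|[x [xJ xv]]] := IHm a (J :\ k) v ltJ.
  left; case: vJ => t [t0 ->]; rewrite -/(in_cone _ _ _).
  apply: in_cone_sum => // i; rewrite in_setD1 => /andP[_].
  exact: in_cone_gen.
have [xk|xk] := leP (ev x (a k)) 0.
  right; exists x; split=> // i iJ; have [->//|ik] := eqVneq i k.
  by apply: xJ; rewrite in_setD1 ik.
pose pr w := w - (ev x w / ev x (a k)) *: a k.
have xk0 : ev x (a k) != 0 by rewrite gt_eqF.
have [[t [t0 vE]]|[y [yJ yv]]] := IHm (pr \o a) (J :\ k) (pr v) ltJ.
  left; have -> : v = \sum_(i in J :\ k) t i *: a i +
      (ev x v / ev x (a k) - \sum_(i in J :\ k) t i * (ev x (a i) / ev x (a k)))
        *: a k.
    rewrite scalerBl scaler_suml addrCA -sumrB.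
    apply/eqP; rewrite -subr_eq0 opprD addrA -/(pr v) vE subr_eq0; apply/eqP.
    by apply: eq_bigr => i _; rewrite /= /pr scalerBr scalerA.
  apply: in_coneD.
    apply: in_cone_sum => // i; rewrite in_setD1 => /andP[_].
    exact: in_cone_gen.
  apply: in_coneZ; last exact: in_cone_gen.
  rewrite subr_ge0; apply: (@le_trans _ _ 0); last by rewrite divr_ge0 // ltW.
  apply: sumr_le0 => i /xJ xi.
  by rewrite mulr_ge0_le0 // mulr_le0_ge0 // invr_ge0 ltW.
right; exists (y - (ev y (a k) / ev x (a k)) *: x).
have prE w : ev (y - (ev y (a k) / ev x (a k)) *: x) w = ev y (pr w).
  rewrite evBl evZl evB evZ; field; exact: xk0.
split=> [i iJ|]; rewrite prE //.
have [->|ik] := eqVneq i k; last by apply: yJ; rewrite in_setD1 ik.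
by rewrite /pr divff // scale1r subrr ev0.
Qed.

(** Other generators may lie on the half-line of [a k]: rays are singled out, not
    indices. *)
Definition exposed_ray a k :=
  a k != 0 /\ exists c, ev c (a k) = 0 /\ forall i, ev c (a i) <= 0 /\
    (ev c (a i) = 0 -> exists2 s, 0 <= s & a i = s *: a k).

(** The members of a minimal generating subfamily are exposed: by Farkas' lemma
    each of them is strictly separated from the cone of the others, and
    subtracting a multiple of the positive functional [h] makes the separating
    functional a supporting one. *)
Lemma exposed_rays_generate a h :
  (forall i, a i != 0 -> 0 < ev h (a i)) ->
  forall j, exists J : {set I},
    (forall k, k \in J -> exposed_ray a k) /\ in_cone a J (a j).
Proof.
move=> h0 j; have hge0 i : 0 <= ev h (a i).
  by have [->|/h0/ltW//] := eqVneq (a i) 0; rewrite ev0.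
pose gen (J : {set I}) := `[< forall i, in_cone a J (a i) >].
have genT : gen [set: I]%SET.
  by apply/asboolP => i; apply: in_cone_gen; rewrite inE.
have [J /minsetP[/asboolP Jgen Jmin] _] := minset_exists genT.
exists J; split=> // k kJ.
have kD : ~ in_cone a (J :\ k) (a k).
  move=> kD; suff JD : J :\ k = J by move: kJ; rewrite -JD setD11.
  apply: Jmin; last exact: subD1set.
  apply/asboolP => i; have [t [t0 ->]] := Jgen i.
  apply: in_cone_sum => // l lJ; have [->//|lk] := eqVneq l k.
  by apply: in_cone_gen; rewrite in_setD1 lk.
have ak : a k != 0.
  by apply/eqP => ak; apply: kD; rewrite ak; apply: in_cone0.
split=> //.
have [//|[c [cJ ck]]] := farkas a (J :\ k) (a k).
have hk := h0 k ak.
(* Tilting [c] by [h] makes it vanish on [a k] and negative on the rest. *)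
pose c' := c - (ev c (a k) / ev h (a k)) *: h.
have c'E w : ev c' w = ev c w - ev c (a k) / ev h (a k) * ev h w.
  by rewrite evBl evZl.
have r0 : 0 < ev c (a k) / ev h (a k) by rewrite divr_gt0.
have c'k : ev c' (a k) = 0 by rewrite c'E divfK ?subrr ?gt_eqF.
have c'J l : l \in J :\ k -> ev c' (a l) <= 0 /\ (ev c' (a l) = 0 -> a l = 0).
  move=> lJ; rewrite c'E; have cl := cJ l lJ; split.
    by rewrite subr_le0 (le_trans cl) // mulr_ge0 // ltW.
  move=> /eqP; rewrite subr_eq0 => /eqP cE.
  apply/eqP; apply: contraTT (cl) => /h0 hl.
  by rewrite cE -ltNge mulr_gt0.
exists c'; split=> // i; have [t [t0 ->]] := Jgen i.
rewrite (bigD1 k) //= evD evZ c'k mulr0 add0r ev_sum.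
have sum_le0 l : (l \in J) && (l != k) -> ev c' (t l *: a l) <= 0.
  move=> /andP[lJ lk]; rewrite evZ mulr_ge0_le0 //.
  by case: (c'J l) => //; rewrite in_setD1 lk.
split; first exact: sumr_le0.
move=> /eqP; rewrite -oppr_eq0 -sumrN psumr_eq0; last first.
  by move=> l /sum_le0; rewrite oppr_ge0.
move=> /allP all0; exists (t k) => //.
rewrite [X in _ + X]big1 ?addr0 // => l /andP[lJ lk].
have := all0 l (mem_index_enum l); rewrite lJ lk /= oppr_eq0 evZ mulf_eq0.
case/orP => /eqP E; first by rewrite E scale0r.
by have [|_ ->//] := c'J l; rewrite ?in_setD1 ?lk // scaler0.
Qed.

End Cones.
(** * From polytopes to finite configurations *)

Section Configurations.
Variables (R : realType) (T : finType).

(** What a polytope with graph [e] and vertices [f x] says about the finite set of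
    its vertices: the faces of the polytope enter only through inequalities
    between values of functionals at vertices. *)
Definition graph_config d (e : rel T) (f : T -> 'rV[R]_d) :=
  (forall x, exists c, forall y, y != x -> ev c (f y) < ev c (f x)) /\
  (forall x y, e x y <-> x != y /\ exists c, ev c (f x) = ev c (f y) /\
     forall z, z != x -> z != y -> ev c (f z) < ev c (f x)).

(** Homogeneous coordinates turn convex hulls into cones. *)
Definition lift d (x : 'rV[R]_d) : 'rV[R]_(d + 1) := row_mx x 1%:M.

Lemma ev_lift d (c : 'cV[R]_(d + 1)) (x : 'rV[R]_d) :
  ev c (lift x) = ev (usubmx c) x + dsubmx c 0 0.
Proof. by rewrite /ev -{1}(vsubmxK c) mul_row_col mul1mx mxE. Qed.

Lemma sum_lift d (K : finType) (Q : pred K) (w : K -> R) (F : K -> 'rV[R]_d) :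
  \sum_(k | Q k) w k *: lift (F k) =
  row_mx (\sum_(k | Q k) w k *: F k) (\sum_(k | Q k) w k)%:M.
Proof.
apply: (big_rec3 (fun a b c => a = row_mx b c%:M)) => [|k a b c _ ->].
  by rewrite raddf0 row_mx0.
by rewrite scale_row_mx scalemx1 add_row_mx -raddfD.
Qed.

Lemma lift_in_cone d (I : finType) (p : I -> 'rV[R]_d) J x :
  in_cone (fun i => lift (p i)) J (lift x) ->
  exists w : I -> R, [/\ forall i, 0 <= w i, \sum_(i in J) w i = 1
    & x = \sum_(i in J) w i *: p i].
Proof.
move=> [w [w0]]; rewrite sum_lift => /eq_row_mx[xE /matrixP/(_ 0 0)].
by rewrite !mxE !mulr1n => w1; exists w.
Qed.

Lemma lift_hull d m (p : 'I_m -> 'rV[R]_d) (w : 'I_m -> R) :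
  \sum_i w i = 1 -> lift (\sum_i w i *: p i) = \sum_i w i *: lift (p i).
Proof. by move=> w1; rewrite sum_lift w1. Qed.

(** A polytope is the convex hull of its vertices: the exposed rays of the cone
    over the points [lift (p i)] pass through the vertices. *)
Lemma hull_of_vertices d m (p : 'I_m -> 'rV[R]_d) (f : T -> 'rV[R]_d) :
  (forall v, is_vertex (conv_hull p) v -> exists y, v = f y) ->
  forall x, conv_hull p x ->
  in_cone (fun y => lift (f y)) [set: T]%SET (lift x).
Proof.
move=> vertf x [w [w0 w1 ->]]; rewrite lift_hull //.
apply: in_cone_sum => // j _ {x w w0 w1}.
pose h : 'cV[R]_(d + 1) := col_mx 0 1%:M.
have hE y : ev h (lift y) = 1.
  by rewrite ev_lift col_mxKu col_mxKd /ev mulmx0 !mxE add0r.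
have [|J [Jexp [t [t0 ->]]]] :=
    @exposed_rays_generate _ _ _ (fun i => lift (p i)) h _ j.
  by move=> i _; rewrite hE.
apply: in_cone_sum => // k /Jexp[_ [c [ck cP]]].
suff /vertf[y ->] : is_vertex (conv_hull p) (p k).
  by apply: (@in_cone_gen _ _ _ (fun y => lift (f y))); rewrite inE.
exists (usubmx c), (- dsubmx c 0 0).
have cE y : ((y *m usubmx c) 0 0 <= - dsubmx c 0 0) = (ev c (lift y) <= 0).
  by rewrite ev_lift -[in RHS]lerBrDr sub0r.
have cE0 y : ((y *m usubmx c) 0 0 = - dsubmx c 0 0) <-> (ev c (lift y) = 0).
  by rewrite ev_lift /ev; split=> [->|/eqP]; rewrite ?addNr // addr_eq0 => /eqP.
split=> [x [w [w0 w1 ->]]|].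
  rewrite cE lift_hull // ev_sum; apply: sumr_le0 => i _.
  by rewrite evZ mulr_ge0_le0 //; case: (cP i).
apply/seteqP; split=> x /=.
  move=> ->; split; last exact/cE0.
  exists (fun i => (i == k)%:R); split=> [i||]; first by rewrite ler0n.
    by rewrite (bigD1 k) //= eqxx big1 ?addr0 // => i /negPf ->.
  rewrite (bigD1 k) //= eqxx scale1r big1 ?addr0 // => i /negPf ->.
  by rewrite scale0r.
case=> [[w [w0 w1 ->]]] /cE0; rewrite lift_hull // ev_sum => /eqP.
rewrite -oppr_eq0 -sumrN psumr_eq0; last first.
  by move=> i _; rewrite oppr_ge0 evZ mulr_ge0_le0 //; case: (cP i).
move=> /allP all0; rewrite -[RHS]scale1r -w1 scaler_suml.
apply: eq_bigr => i _; have := all0 i (mem_index_enum i).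
rewrite /= oppr_eq0 evZ mulf_eq0 => /orP[/eqP->|/eqP].
  by rewrite !scale0r.
case: (cP i) => _ /[apply] -[s _ piE]; congr (_ *: _).
have s1 : s = 1 by have := congr1 (ev h) piE; rewrite evZ !hE mulr1.
by move: piE; rewrite s1 scale1r => /eq_row_mx[].
Qed.

Lemma vertex_in_segment d (f : T -> 'rV[R]_d) x y z t :
  (forall x, exists c, forall y, y != x -> ev c (f y) < ev c (f x)) ->
  0 <= t <= 1 -> f z = (1 - t) *: f x + t *: f y -> (z == x) || (z == y).
Proof.
move=> vertf /andP[t0 t1] fz; have [c cz] := vertf z.
apply: contraT; rewrite negb_or ![z == _]eq_sym => /andP[/cz xz /cz yz].
have := congr1 (ev c) fz; rewrite evD !evZ.
have [t1'|t1'] := ltP t 1; last first.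
  have -> : t = 1 by lra.
  lra.
have tz : 0 < (1 - t) * (ev c (f z) - ev c (f x)).
  by apply: mulr_gt0; rewrite subr_gt0.
have tz2 : 0 <= t * (ev c (f z) - ev c (f y)).
  by apply: mulr_ge0 => //; rewrite subr_ge0 ltW.
lra.
Qed.

Lemma conv_hull_segment d m (p : 'I_m -> 'rV[R]_d) u v x :
  conv_hull p u -> conv_hull p v -> segment u v x -> conv_hull p x.
Proof.
move=> [s [s0 s1 ->]] [t [t0 t1 ->]] [r [/andP[r0 r1] ->]].
exists (fun i => (1 - r) * s i + r * t i); split=> [i||].
- by rewrite addr_ge0 // mulr_ge0 // subr_ge0.
- by rewrite big_split /= -!mulr_sumr s1 t1 !mulr1 subrK.
rewrite !scaler_sumr -big_split; apply: eq_bigr => i _ /=.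
by rewrite !scalerA -scalerDl.
Qed.

Lemma polytopal_config (e : rel T) :
  polytopal R e -> exists d (f : T -> 'rV[R]_d), graph_config e f.
Proof.
move=> [d [P [f [[m [p PE]] finj frange eE]]]]; exists d, f; subst P.
have fP x : is_vertex (conv_hull p) (f x) by rewrite -frange; exists x.
have fin x : conv_hull p (f x).
  by have [c [b [_ /seteqP[/(_ (f x) erefl)[]]]]] := fP x.
have vertf x : exists c, forall y, y != x -> ev c (f y) < ev c (f x).
  have [c [b [cb cE]]] := fP x; exists c => y yx.
  have [_ fxb] : [set z | conv_hull p z /\ (z *m c) 0 0 = b]%classic (f x).
    by rewrite -cE.
  rewrite /ev fxb lt_neqAle cb // andbT; apply/eqP => fyb.
  suff /finj yE : f y = f x by rewrite yE eqxx in yx.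
  suff : [set f x]%classic (f y) by [].
  by rewrite cE.
split=> // x y; rewrite eE; split.
  move=> [_ _ fxy [c [b [cb cE]]]].
  split; first by apply/eqP => xy; apply: fxy; rewrite xy.
  have cE' z : segment (f x) (f y) z <-> conv_hull p z /\ (z *m c) 0 0 = b.
    by rewrite cE.
  have [_ fxb] : conv_hull p (f x) /\ (f x *m c) 0 0 = b.
    apply/cE'; exists 0; rewrite lexx ler01; split=> //.
    by rewrite subr0 scale1r scale0r addr0.
  have [_ fyb] : conv_hull p (f y) /\ (f y *m c) 0 0 = b.
    apply/cE'; exists 1; rewrite lexx ler01; split=> //.
    by rewrite subrr scale1r scale0r add0r.
  exists c; rewrite /ev fxb fyb; split=> // z zx zy.
  rewrite lt_neqAle cb // andbT; apply/eqP => fzb.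
  have [t [t01 fzE]] : segment (f x) (f y) (f z) by apply/cE'.
  by have := vertex_in_segment vertf t01 fzE; rewrite (negPf zx) (negPf zy).
move=> [xy [c [cxy cP]]]; split=> //.
  by move=> /finj E; rewrite E eqxx in xy.
have cle z : ev c (f z) <= ev c (f x).
  have [->//|zx] := eqVneq z x.
  have [->|zy] := eqVneq z y; first by rewrite cxy.
  by rewrite ltW // cP.
have hullT u : conv_hull p u -> exists w : T -> R,
    [/\ forall i, 0 <= w i, \sum_i w i = 1 & u = \sum_i w i *: f i].
  move=> pu.
  have [|w [w0 w1 uE]] := lift_in_cone (@hull_of_vertices _ _ _ f _ u pu).
    by move=> v; rewrite -frange => -[z _ <-]; exists z.
  exists w; split=> //; first by rewrite -w1; apply: eq_bigl => i; rewrite inE.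
  by rewrite uE; apply: eq_bigl => i; rewrite inE.
exists c, (ev c (f x)); split=> [u /hullT[w [w0 w1 ->]]|].
  rewrite -/(ev c _) ev_sum -[leRHS]mul1r -w1 mulr_suml; apply: ler_sum => z _.
  by rewrite evZ ler_wpM2l.
apply/seteqP; split=> u /=.
  move=> useg; split; first exact: conv_hull_segment useg.
  by case: useg => t [_ ->]; rewrite -/(ev c _) evD !evZ -cxy; ring.
case=> /hullT[w [w0 w1 uE]]; rewrite -/(ev c u) uE ev_sum => /eqP.
rewrite -subr_eq0 -[X in _ - X]mul1r -w1 mulr_suml -sumrB -oppr_eq0 -sumrN.
rewrite psumr_eq0; last first.
  by move=> z _; rewrite evZ -mulrBr -mulrN mulr_ge0 // opprB subr_ge0.
move=> /allP all0.
have w0z z : z != x -> z != y -> w z = 0.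
  move=> zx zy; have := all0 z (mem_index_enum z).
  rewrite /= evZ -mulrBr oppr_eq0 mulf_eq0 => /orP[/eqP//|].
  by rewrite subr_eq0 lt_eqF // cP.
have wx : w x = 1 - w y.
  rewrite -w1 (bigD1 x) //= (bigD1 y) ?(eq_sym y) //= big1 ?addr0 ?addrK //.
  by move=> z /andP[]; exact: w0z.
exists (w y); split.
  by rewrite w0 /= -subr_ge0 -wx.
rewrite -wx (bigD1 x) //= (bigD1 y) ?(eq_sym y) //= big1 ?addr0 //.
by move=> z /andP[zx zy]; rewrite w0z // scale0r.
Qed.

End Configurations.
(** * Vertex cones and simple vertices *)

Section VertexCones.
Variables (R : realType) (T : finType) (d q : nat).
Variables (e : rel T) (f : T -> 'rV[R]_d) (nb : T -> 'I_q -> T).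
Hypothesis ef : graph_config e f.
Hypothesis enb : forall x y, e x y <-> exists k, y = nb x k.

Lemma config_edge_neq x y : e x y -> x != y.
Proof. by case: ef => _ /[apply]-[]. Qed.

(** A ray of directions from [x] contains at most one other vertex: of two, the
    nearer one would lie between [x] and the farther one. *)
Lemma exposed_ray_edge x k : exposed_ray (fun y => f y - f x) k -> e x k.
Proof.
have [vertf eE] := ef; move=> [k0 [c [ck cP]]]; apply/eE.
have xk : x != k by apply: contraNneq k0 => ->; rewrite subrr.
split=> //; exists c; split.
  by apply/eqP; rewrite eq_sym -subr_eq0 -evB ck.
move=> z zx zk; have [] := cP z; rewrite evB subr_le0 le_eqVlt.
case/orP=> [/eqP cz|//]; rewrite cz subrr => /(_ erefl)[s s0 fz].
have fzE : f z = f x + s *: (f k - f x) by rewrite -fz addrC subrK.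
have [s1|s1] := leP s 1.
  have /= := @vertex_in_segment _ _ _ f x k z s vertf.
  rewrite s0 s1 (negPf zx) (negPf zk) => /(_ isT) E.
  exfalso; suff /E : f z = (1 - s) *: f x + s *: f k by [].
  by rewrite fzE scalerBr scalerBl scale1r addrCA addrC.
have sn0 : s != 0 by rewrite gt_eqF // (lt_trans _ s1).
have /= := @vertex_in_segment _ _ _ f x z k s^-1 vertf.
rewrite ![k == _]eq_sym (negPf xk) (negPf zk) invr_ge0 s0.
rewrite invf_le1 ?(lt_trans _ s1) // ltW //= => /(_ isT) E.
exfalso; suff /E : f k = (1 - s^-1) *: f x + s^-1 *: f z by [].
rewrite fzE scalerDr scalerA mulVf // scale1r scalerBl scale1r.
by rewrite addrA subrK addrC subrK.
Qed.

(** The exposed rays of the cone of all directions from [x] are edges. *)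
Lemma nb_cone x z : exists t : 'I_q -> R, (forall k, 0 <= t k) /\
  f z - f x = \sum_k t k *: (f (nb x k) - f x).
Proof.
have [c cx] := ef.1 x.
have [|J [Jexp [t [t0 ->]]]] :=
    @exposed_rays_generate _ _ _ (fun y => f y - f x) (- c) _ z.
  move=> y y0; have yx : y != x by apply: contraNneq y0 => ->; rewrite subrr.
  by rewrite evNl evB opprB subr_gt0 cx.
have [|s [s0 ->]] := @in_cone_sum _ _ _ (fun k => f (nb x k) - f x)
   [set: 'I_q]%SET T (mem J) t (fun y => f y - f x) t0; last first.
  by exists s; split=> //; apply: eq_bigl => k; rewrite inE.
move=> y /Jexp/exposed_ray_edge/enb[k ->].
by apply: (@in_cone_gen _ _ _ (fun k => f (nb x k) - f x)); rewrite inE.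
Qed.

Definition edge_mx x : 'M[R]_(q, d) := \matrix_k (f (nb x k) - f x).

Lemma nb_cone_sub x z y : (f z - f y <= edge_mx x)%MS.
Proof.
have sub w : (f w - f x <= edge_mx x)%MS.
  have [t [_ ->]] := nb_cone x w; apply: summx_sub => k _.
  apply: scalemx_sub.
  by rewrite -[_ - _](rowK (fun k => f (nb x k) - f x)) row_sub.
by rewrite -[f z](subrK (f x)) -addrA addmx_sub // -opprB eqmx_opp.
Qed.

Lemma edge_mx_sub x y : (edge_mx x <= edge_mx y)%MS.
Proof. by apply/row_subP => k; rewrite rowK nb_cone_sub. Qed.

(** The edge directions at any vertex span the direction space of the whole
    polytope. *)
Lemma simple_everywhere x y : row_free (edge_mx x) -> row_free (edge_mx y).
Proof.
rewrite -!row_leq_rank => /leq_trans; apply.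
exact: mxrankS (edge_mx_sub x y).
Qed.

Lemma simple_dual x (v : 'I_q -> R) : row_free (edge_mx x) ->
  exists c, forall k, ev c (f (nb x k) - f x) = v k.
Proof.
move=> xfree; exists (pinvmx (edge_mx x) *m \col_k v k) => k.
rewrite -[f _ - _](rowK (fun k => f (nb x k) - f x)) -/(edge_mx x).
by rewrite /ev -row_mul mulmxA mulmxVp // mul1mx !mxE.
Qed.

(** The face where [c] is maximal has codimension at most 1, by its behaviour at
    [x].  Its directions are spanned by the edges at [y] that it contains; if
    two edges at [y] were missing, these would be too few. *)
Lemma facet_misses_one c x y k0 l1 l2 :
  row_free (edge_mx x) -> (forall z, ev c (f z) <= ev c (f x)) ->
  (forall k, k != k0 -> ev c (f (nb x k)) = ev c (f x)) ->
  ev c (f y) = ev c (f x) -> l1 != l2 ->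
  ev c (f (nb y l1)) < ev c (f x) -> ev c (f (nb y l2)) < ev c (f x) -> False.
Proof.
move=> xfree cle ck cy l12 c1 c2.
pose B := (\sum_(l | l \notin [set l1; l2]%SET) <<f (nb y l) - f y>>)%MS.
have inB z : ev c (f z) = ev c (f x) -> (f z - f y <= B)%MS.
  have [t [t0 fz]] := nb_cone y z => cz.
  have : \sum_k t k * (ev c (f x) - ev c (f (nb y k))) = 0.
    transitivity (- ev c (f z - f y)); last by rewrite evB cz cy subrr oppr0.
    rewrite fz ev_sum -sumrN; apply: eq_bigr => k _.
    by rewrite evZ evB cy -mulrN opprB.
  move/eqP; rewrite psumr_eq0 => [/allP all0|k _]; last first.
    by rewrite mulr_ge0 ?subr_ge0.
  rewrite fz; apply: summx_sub => k _.
  have [k12|k12] := boolP (k \in [set l1; l2]%SET).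
    have := all0 k (mem_index_enum k).
    rewrite /= mulf_eq0 => /orP[/eqP->|]; first by rewrite scale0r sub0mx.
    by rewrite subr_eq0 gt_eqF //; case/set2P: k12 => ->.
  apply: scalemx_sub; apply: submx_trans (sumsmx_sup k k12 (submx_refl _)).
  by rewrite genmxE.
pose r := f (nb x k0) - f x.
have : (edge_mx x <= B + r)%MS.
  apply/row_subP => k; rewrite rowK.
  have [->|kk0] := eqVneq k k0; first exact: addsmxSr.
  apply: submx_trans (addsmxSl _ _).
  rewrite -[f (nb x k)](subrK (f y)) -addrA addmx_sub //; first exact/inB/ck.
  by rewrite -opprB eqmx_opp inB.
move=> /mxrankS; rewrite (eqP xfree) leqNgt => /negP; apply.
apply: leq_ltn_trans (mxrank_adds_leqif B r) _.
have rr : (\rank r <= 1)%N by apply: rank_leq_row.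
have Br : (\rank B <= #|~: [set l1; l2]%SET|)%N.
  apply: leq_trans (mxrank_sum_leqif _) _ => /=.
  rewrite -sum1_card; under [leqRHS]eq_bigl => i do rewrite inE.
  by apply: leq_sum => i _; rewrite genmxE rank_leq_row.
have q2 := max_card (mem [set l1; l2]%SET).
move: Br; rewrite cardsCs finset.setCK cards2 l12 card_ord.
rewrite cards2 l12 card_ord in q2 => Br.
apply: leq_ltn_trans (leq_add Br rr) _.
by rewrite -{2}(subnK q2) ltn_add2l.
Qed.

(** At the simple vertex [w] the two edges span a 2-face, which lies in their
    cone.  The face where [c] is maximal contains both neighbours but not [w], so
    it cuts this cone exactly in the segment between them. *)
Lemma simple_chord c w k l :
  row_free (edge_mx w) -> nb w k != nb w l ->
  (forall z, ev c (f z) <= ev c (f (nb w k))) ->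
  ev c (f (nb w l)) = ev c (f (nb w k)) ->
  ev c (f w) < ev c (f (nb w k)) -> e (nb w k) (nb w l).
Proof.
move=> wfree kl cle cl cw.
have kl' : k != l by apply: contraNneq kl => ->.
have [c' c'P] := simple_dual (fun j => - (j \notin [set k; l]%SET)%:R) wfree.
apply/ef.2; split=> //; exists (c + c').
have c'k : ev c' (f (nb w k)) = ev c' (f w).
  by apply/eqP; rewrite -subr_eq0 -evB c'P !inE eqxx oppr0.
have c'l : ev c' (f (nb w l)) = ev c' (f w).
  by apply/eqP; rewrite -subr_eq0 -evB c'P !inE eqxx orbT oppr0.
split=> [|z zk zl]; first by rewrite !evDl cl c'k c'l.
have [t [t0 fz]] := nb_cone w z.
have c'z : ev c' (f z) - ev c' (f w) = - \sum_(j | j \notin [set k; l]%SET) t j.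
  rewrite -evB fz ev_sum [in RHS]big_mkcond -sumrN; apply: eq_bigr => j _.
  by rewrite evZ c'P; case: ifP => _; rewrite ?mulrN1 // oppr0 mulr0.
have s0 : 0 <= \sum_(j | j \notin [set k; l]%SET) t j by apply: sumr_ge0.
rewrite !evDl c'k ltNge; apply/negP => le1.
have cz := cle z.
have /eqP : \sum_(j | j \notin [set k; l]%SET) t j = 0 by lra.
rewrite psumr_eq0 // => /allP all0.
have fz2 : f z - f w = t k *: (f (nb w k) - f w) + t l *: (f (nb w l) - f w).
  rewrite fz (bigD1 k) //= (bigD1 l) ?(eq_sym l) //= big1 ?addr0 //.
  move=> j /andP[jk jl].
  have := all0 j (mem_index_enum j).
  by rewrite !inE (negPf jk) (negPf jl) /= => /eqP ->; rewrite scale0r.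
have cz2 : ev c (f z) = ev c (f (nb w k)) by lra.
have tkl : t k + t l = 1.
  have := congr1 (ev c) fz2; rewrite evB evD !evZ !evB cl cz2 -mulrDl.
  move=> E; apply: (@mulIf _ (ev c (f (nb w k)) - ev c (f w))).
    by rewrite subr_eq0 gt_eqF.
  by rewrite mul1r.
have tk : t k = 1 - t l by rewrite -tkl addrK.
have := @vertex_in_segment _ _ _ f (nb w k) (nb w l) z (t l) ef.1.
rewrite (negPf zk) (negPf zl) t0 -subr_ge0 -tk t0 => /(_ isT) E.
suff /E : f z = t k *: f (nb w k) + t l *: f (nb w l) by [].
rewrite -[LHS](subrK (f w)) fz2 !scalerBr addrACA -opprD -scalerDl tkl scale1r.
by rewrite subrK.
Qed.

End VertexCones.
(** * Crossing paths in the plane *)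

Section PlanePaths.
Variable R : realFieldType.
Implicit Types a b c : R * R.

Definition det2 a b : R := a.1 * b.2 - a.2 * b.1.

(** The segment from [a] to [b] crosses the upper half of the vertical axis, where
    points on the axis count as lying to its right. *)
Definition crosses a b :=
  if 0 <= a.1 then (b.1 < 0) && (0 < det2 a b)
  else (0 <= b.1) && (det2 a b < 0).

Lemma det2C a b : det2 a b = - det2 b a.
Proof. rewrite /det2; ring. Qed.

Lemma crossesC a b : crosses a b = crosses b a.
Proof.
rewrite /crosses (det2C b a) oppr_gt0 oppr_lt0.
by case: (leP 0 a.1) => _; case: (leP 0 b.1) => _.
Qed.

Lemma crosses_same a b : (0 <= a.1) = (0 <= b.1) -> crosses a b = false.
Proof. by rewrite /crosses => ->; case: ltP. Qed.

Lemma crosses_below a b : a.2 < 0 -> b.2 < 0 -> crosses a b = false.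
Proof.
move=> a2 b2; rewrite /crosses /det2.
case: (leP 0 a.1) => a1; case: (leP 0 b.1) => b1 //=; apply/negbTE.
  by rewrite -leNgt; nra.
by rewrite -leNgt; nra.
Qed.

Lemma crosses_above a b : 0 < a.2 -> 0 < b.2 ->
  crosses a b = (0 <= a.1) (+) (0 <= b.1).
Proof.
move=> a2 b2; rewrite /crosses /det2.
case: (leP 0 a.1) => a1; case: (leP 0 b.1) => b1 //=; nra.
Qed.

Definition hull_avoids0 a b c := forall s t u : R, 0 <= s -> 0 <= t -> 0 <= u ->
  s * a.1 + t * b.1 + u * c.1 = 0 -> s * a.2 + t * b.2 + u * c.2 = 0 ->
  s + t + u = 0.

(** The three determinants are the coefficients of a linear relation between [a],
    [b] and [c].  If only one of the two segments from [a] crossed the upper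
    half-axis, they would have the same sign and put 0 in the triangle. *)
Lemma crosses_lone a b c : hull_avoids0 a b c ->
  (0 <= b.1) = (0 <= c.1) -> (0 <= a.1) != (0 <= b.1) ->
  crosses a b -> crosses a c.
Proof.
move=> abc bc; rewrite /crosses -bc.
have id1 : det2 b c * a.1 + det2 c a * b.1 + det2 a b * c.1 = 0.
  by rewrite /det2; ring.
have id2 : det2 b c * a.2 + det2 c a * b.2 + det2 a b * c.2 = 0.
  by rewrite /det2; ring.
case: (leP 0 a.1) => a1; case: (leP 0 b.1) bc => b1;
  case: (leP 0 c.1) => c1 //= _ _.
  move=> ab; rewrite ltNge; apply/negP => ac.
  have ca : 0 <= det2 c a by rewrite det2C oppr_ge0.
  have bc : 0 <= det2 b c by nra.
  by have := abc _ _ _ bc ca (ltW ab) id1 id2; lra.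
move=> ab; rewrite ltNge; apply/negP => ac.
have ca : 0 <= - det2 c a by rewrite -det2C.
have bc : 0 <= - det2 b c by nra.
have ab' : 0 <= - det2 a b by lra.
have := abc _ _ _ bc ca ab'; rewrite !mulNr -!opprD id1 id2 oppr0.
by move=> /(_ erefl erefl); lra.
Qed.

Lemma hull_avoids0C a b c : hull_avoids0 a b c -> hull_avoids0 a c b.
Proof.
move=> abc s t u s0 t0 u0 E1 E2.
rewrite (_ : s + t + u = s + u + t); last by ring.
by apply: abc => //; lra.
Qed.

Lemma hull_avoids0r a b c : hull_avoids0 a b c -> hull_avoids0 b c a.
Proof.
move=> abc s t u s0 t0 u0 E1 E2.
rewrite (_ : s + t + u = u + s + t); last by ring.
by apply: abc => //; lra.
Qed.

Lemma crosses_triangle a b c : hull_avoids0 a b c ->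
  crosses a b (+) crosses b c (+) crosses a c = false.
Proof.
have lone x y z : hull_avoids0 x y z -> (0 <= y.1) = (0 <= z.1) ->
    (0 <= x.1) != (0 <= y.1) -> crosses x y = crosses x z.
  move=> xyz yz xy; apply/idP/idP; first exact: crosses_lone.
  by apply: crosses_lone; rewrite -?yz //; apply: hull_avoids0C.
move=> abc; have bca := hull_avoids0r abc; have cab := hull_avoids0r bca.
have [ab|ab] := eqVneq (0 <= a.1) (0 <= b.1).
  rewrite (crosses_same ab) /= (crossesC b c) (crossesC a c).
  have [bc|bc] := eqVneq (0 <= c.1) (0 <= b.1).
    by rewrite !crosses_same ?ab.
  by rewrite (lone c a b) ?addbb // ab.
have [bc|bc] := eqVneq (0 <= b.1) (0 <= c.1).
  by rewrite (crosses_same bc) (lone a b c) // addbF addbb.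
rewrite (@crosses_same a c); last by move: ab bc; do 3!case: (0 <= _).
rewrite addbF (crossesC a b) (lone b c a) ?addbb //.
by move: ab bc; do 3!case: (0 <= _).
Qed.

(** If the two polygonal paths did not meet, the differences [A i - B j] would
    form a map from a grid to the punctured plane.  The parity of its winding
    number, counted by crossings of a half-axis, vanishes around each cell and
    hence around the grid; but the boundary crosses the half-axis on one side
    only, an odd number of times. *)
Lemma plane_paths_meet (A B : nat -> R * R) k l :
  (forall i, (i <= k)%N -> (B l).2 < (A i).2 < (B 0).2) ->
  (forall j, (j <= l)%N -> (A k).1 < (B j).1 < (A 0).1) ->
  exists i j s t u v, [/\ (i < k)%N && (j < l)%N,
    [/\ 0 <= s, 0 <= t, 0 <= u & 0 <= v], 0 < s + t, s + t = u + v &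
    s * (A i).1 + t * (A i.+1).1 = u * (B j).1 + v * (B j.+1).1 /\
    s * (A i).2 + t * (A i.+1).2 = u * (B j).2 + v * (B j.+1).2].
Proof.
move=> AB2 AB1; apply: contrapT => noX.
pose D i j := ((A i).1 - (B j).1, (A i).2 - (B j).2).
have cell i j : (i < k)%N -> (j < l)%N ->
  crosses (D i j) (D i.+1 j) (+) crosses (D i j.+1) (D i.+1 j.+1) =
  crosses (D i j) (D i j.+1) (+) crosses (D i.+1 j) (D i.+1 j.+1).
  move=> ik jl.
  have meet s t u v : 0 <= s -> 0 <= t -> 0 <= u -> 0 <= v -> s + t = u + v ->
      s * (A i).1 + t * (A i.+1).1 = u * (B j).1 + v * (B j.+1).1 ->
      s * (A i).2 + t * (A i.+1).2 = u * (B j).2 + v * (B j.+1).2 -> s + t = 0.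
    move=> s0 t0 u0 v0 stuv E1 E2; apply/eqP; rewrite eq_le addr_ge0 // andbT.
    rewrite leNgt; apply/negP => st0; apply: noX.
    by exists i, j, s, t, u, v; rewrite ik jl.
  (* A diagonal cuts the cell into two triangles. *)
  have T1 : hull_avoids0 (D i j) (D i j.+1) (D i.+1 j.+1).
    move=> s t u s0 t0 u0 /= E1 E2.
    by apply: (meet (s + t) u s (t + u)); rewrite ?addr_ge0 //; lra.
  have T2 : hull_avoids0 (D i j) (D i.+1 j) (D i.+1 j.+1).
    move=> s t u s0 t0 u0 /= E1 E2.
    have -> : s + t + u = s + (t + u) by ring.
    by apply: (meet s (t + u) (s + t) u); rewrite ?addr_ge0 //; lra.
  move: (crosses_triangle T1) (crosses_triangle T2).
  by do 5!case: crosses.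
have column j : (j < l)%N -> forall i, (i <= k)%N ->
  \big[addb/false]_(0 <= h < i) crosses (D h j) (D h.+1 j) (+)
  \big[addb/false]_(0 <= h < i) crosses (D h j.+1) (D h.+1 j.+1) =
  crosses (D 0 j) (D 0 j.+1) (+) crosses (D i j) (D i j.+1).
  move=> jl; elim=> [|i IHi] ik; first by rewrite !big_geq // !addbb.
  rewrite !big_nat_recr //=.
  rewrite addbACA (IHi (ltnW ik)) (cell _ _ ik jl) addbA.
  by rewrite -(addbA (crosses (D 0 j) _)) addbb addbF.
have rows j : (j <= l)%N ->
  \big[addb/false]_(0 <= h < k) crosses (D h 0) (D h.+1 0) =
  \big[addb/false]_(0 <= h < k) crosses (D h j) (D h.+1 j).
  elim: j => // j IHj jl; rewrite IHj ?(ltnW jl) //.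
  have [B0 B1] := (AB1 j (ltnW jl), AB1 j.+1 jl).
  have := column j jl k (leqnn k); rewrite !crosses_same /=; first last.
  - by rewrite !subr_ge0 !leNgt; lra.
  - by rewrite !subr_ge0; lra.
  by do 2!case: (bigop _ _ _).
have bottom : \big[addb/false]_(0 <= h < k) crosses (D h 0) (D h.+1 0) = false.
  rewrite big_nat big1 // => h /andP[_ hk].
  have /andP[_ a0] := AB2 h (ltnW hk); have /andP[_ a1] := AB2 h.+1 hk.
  by apply: crosses_below; rewrite /= subr_lt0.
have top i : (i <= k)%N ->
    \big[addb/false]_(0 <= h < i) crosses (D h l) (D h.+1 l) =
    (0 <= (D 0 l).1) (+) (0 <= (D i l).1).
  elim: i => [|i IHi] ik; first by rewrite big_geq // addbb.
  rewrite big_nat_recr //= IHi ?(ltnW ik) //.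
  have /andP[a0 _] := AB2 i (ltnW ik); have /andP[a1 _] := AB2 i.+1 ik.
  rewrite crosses_above ?subr_gt0 //.
  by rewrite -addbA (addbA (0 <= (D i l).1)) addbb.
have /andP[Bk B0] := AB1 l (leqnn l).
have := top k (leqnn k); rewrite -rows // bottom /= !subr_ge0.
by rewrite (ltW B0) leNgt Bk.
Qed.

End PlanePaths.
(** * Crossing paths around a vertex with dependent edges *)

Section NonSimpleVertex.
Variables (R : realType) (T : finType) (d : nat).
Variables (e : rel T) (f : T -> 'rV[R]_d) (nb : T -> 'I_4 -> T).
Hypothesis ef : graph_config e f.
Hypothesis enb : forall x y, e x y <-> exists k, y = nb x k.
Hypothesis nb_inj : forall x, injective (nb x).
Variable u : T.

Let r z : 'rV[R]_d := f z - f u.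
Let rk k : 'rV[R]_d := r (nb u k).

Lemma edge_nb k : e u (nb u k).
Proof. by apply/enb; exists k. Qed.

Lemma height : exists h, forall z, z != u -> 0 < ev h (r z).
Proof.
have [c cu] := ef.1 u; exists (- c) => z zu.
by rewrite evNl evB opprB subr_gt0 cu.
Qed.

Lemma nb_neq k : nb u k != u.
Proof. by rewrite eq_sym (config_edge_neq ef (edge_nb k)). Qed.

Lemma nb_edge_functional k : exists c, ev c (rk k) = 0 /\
  forall z, z != u -> z != nb u k -> ev c (r z) < 0.
Proof.
have [_ [c [cuk cz]]] := (ef.2 _ _).1 (edge_nb k).
exists c; split=> [|z zu zk]; first by rewrite evB cuk subrr.
by rewrite evB subr_lt0 cz.
Qed.

Lemma mem_ord4 (s : seq 'I_4) k : uniq s -> size s = 4 -> k \in s.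
Proof.
move=> us s4; have sz : #|s| = #|'I_4| by rewrite card_ord (card_uniqP us).
have /(subset_cardP sz)-> // : s \subset 'I_4 by apply/fintype.subsetP.
Qed.

Lemma sum_ord4 (V : nmodType) (F : 'I_4 -> V) (s : seq 'I_4) :
  uniq s -> size s = 4 -> \sum_k F k = \sum_(k <- s) F k.
Proof.
move=> us s4; rewrite [RHS]big_uniq //; apply: eq_bigl => k.
by rewrite (mem_ord4 k us s4).
Qed.

(** The functional that exposes the edge to [nb u i] vanishes on [rk i] and is
    negative on the other edge directions. *)
Lemma dependence_pos (m : 'I_4 -> R) i : \sum_k m k *: rk k = 0 ->
  (exists k, m k != 0) -> exists2 j, j != i & 0 < m j.
Proof.
move=> mr [k0 mk0]; have [c [ci cP]] := nb_edge_functional i.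
apply: contrapT => none.
have mle j : j != i -> m j <= 0.
  by move=> ji; rewrite leNgt; apply/negP => mj; apply: none; exists j.
have clt j : j != i -> ev c (rk j) < 0.
  by move=> ji; apply: cP; rewrite ?nb_neq ?(inj_eq (@nb_inj u)).
have := congr1 (ev c) mr.
rewrite ev0 ev_sum (bigD1 i) //= evZ ci mulr0 add0r => /eqP.
rewrite psumr_eq0 => [/allP all0|j ji]; last first.
  by rewrite evZ mulr_le0 ?mle // ltW // clt.
have m0 j : j != i -> m j = 0.
  move=> ji; have := all0 j (mem_index_enum j); rewrite ji /= evZ mulf_eq0.
  by rewrite (lt_eqF (clt _ ji)) orbF => /eqP.
have k0i : k0 = i by apply/eqP; apply: contraNT mk0 => /m0 ->.
move: mr; rewrite (bigD1 i) //= big1 => [|j /m0 ->]; last by rewrite scale0r.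
rewrite addr0 => /eqP; rewrite scaler_eq0 -{1}k0i (negPf mk0) /= => /eqP ri.
have [h hP] := height; have := hP (nb u i).
by rewrite nb_neq -/(rk i) ri ev0 ltxx => /(_ isT).
Qed.

(** Each edge direction is extreme, so for every [i] a dependence has
    coefficients of both signs off [i].  Opposite corners of the quadrilateral
    seen from [u] are those with coefficients of the same sign. *)
Lemma dependence_pattern (m : 'I_4 -> R) : \sum_k m k *: rk k = 0 ->
  (exists k, m k != 0) -> exists j1 j2 j3 j4, uniq [:: j1; j2; j3; j4] /\
  [/\ 0 < m j1, 0 < m j2, m j3 < 0 & m j4 < 0].
Proof.
move=> mr m0; have pos := dependence_pos _ mr m0.
have neg i : exists2 j, j != i & m j < 0.
  have [|//|j ji mj] := @dependence_pos (fun k => - m k) i.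
  - under eq_bigr do rewrite scaleNr.
    by rewrite sumrN mr oppr0.
  - by have [k mk] := m0; exists k; rewrite oppr_eq0.
  by exists j => //; rewrite -oppr_gt0.
have [j1 _ m1] := pos ord0; have [j2 j21 m2] := pos j1.
have [j3 _ m3] := neg ord0; have [j4 j43 m4] := neg j3.
have pn i j : 0 < m i -> m j < 0 -> i != j.
  by move=> mi mj; apply/eqP => ij; move: mj; rewrite -ij; lra.
exists j1, j2, j3, j4; split=> //=; rewrite !inE !negb_or.
by rewrite (eq_sym j1 j2) j21 (eq_sym j3 j4) j43 !pn.
Qed.

(** Segments that overlap when seen from [u].  By the inequality between the sums
    of coefficients, the point on the edge between [a] and [b] is the nearer one:
    it lies between [u] and the other point.  As an edge is a face, it then
    contains the other point too, and [a'] or [b']. *)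
Lemma crossing_segments h a b a' b' (s t s' t' : R) :
  (forall z, z != u -> 0 < ev h (r z)) ->
  e a b -> a != u -> b != u -> a' \notin [:: a; b] -> b' \notin [:: a; b] ->
  0 <= s -> 0 <= t -> 0 <= s' -> 0 <= t' -> s' + t' <= s + t ->
  s *: r a + t *: r b = s' *: r a' + t' *: r b' -> s + t = 0.
Proof.
move=> hP ab au bu a'ab b'ab s0 t0 s0' t0' st E.
have [_ [c [cab cz]]] := (ef.2 _ _).1 ab.
have [ca' cb'] : ev c (f a') < ev c (f a) /\ ev c (f b') < ev c (f a).
  move: a'ab b'ab; rewrite !inE !negb_or => /andP[? ?] /andP[? ?].
  by split; apply: cz.
have cu : ev c (f u) <= ev c (f a) by rewrite ltW // cz // eq_sym.
have := congr1 (ev c) E; rewrite !evD !evZ !evB -cab => cE.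
have t1 : 0 <= s' * (ev c (f a) - ev c (f a')) by apply: mulr_ge0 => //; lra.
have t2 : 0 <= t' * (ev c (f a) - ev c (f b')) by apply: mulr_ge0 => //; lra.
have t3 : 0 <= (s + t - s' - t') * (ev c (f a) - ev c (f u)).
  by apply: mulr_ge0; lra.
have s'0 : s' = 0.
  have /eqP : s' * (ev c (f a) - ev c (f a')) = 0 by lra.
  by rewrite mulf_eq0 subr_eq0 (gt_eqF ca') orbF => /eqP.
have t'0 : t' = 0.
  have /eqP : t' * (ev c (f a) - ev c (f b')) = 0 by lra.
  by rewrite mulf_eq0 subr_eq0 (gt_eqF cb') orbF => /eqP.
have := congr1 (ev h) E; rewrite s'0 t'0 !scale0r addr0 ev0 evD !evZ => /eqP.
have [ha hb] := (hP a au, hP b bu).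
rewrite paddr_eq0; [|by rewrite mulr_ge0 // ltW..].
rewrite !mulf_eq0 (gt_eqF ha) (gt_eqF hb) !orbF.
by move=> /andP[/eqP-> /eqP->]; rewrite addr0.
Qed.

(** [nb u j] is the only vertex that is seen in its direction, so it is the only
    one where the slope [g / h] is largest. *)
Lemma extreme_slope h g j z :
  (forall z, z != u -> 0 < ev h (r z)) ->
  0 < ev g (rk j) -> (forall k, k != j -> ev g (rk k) <= 0) ->
  z != u -> z != nb u j -> ev g (r z) / ev h (r z) < ev g (rk j) / ev h (rk j).
Proof.
move=> hP gj gk zu zj.
have hk k : 0 < ev h (rk k) by apply: hP; apply: nb_neq.
rewrite ltr_pdivrMr ?hP // mulrAC ltr_pdivlMr //.
have [t [t0 rz]] := nb_cone ef enb u z; rewrite -/(r z) in rz.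
rewrite ltNge; apply/negP => le1.
pose gap k := ev g (rk k) * ev h (rk j) - ev g (rk j) * ev h (rk k).
have term k : k != j -> gap k < 0.
  move=> kj; have := gk k kj; have := hk k; have := hk j => h1 h2 g1.
  have t1 : 0 < ev g (rk j) * ev h (rk k) by rewrite mulr_gt0.
  have t2 : ev g (rk k) * ev h (rk j) <= 0 by rewrite mulr_le0_ge0 // ltW.
  rewrite /gap; lra.
have sle : \sum_(k | k != j) - (t k * gap k) <= 0.
  have -> : \sum_(k | k != j) - (t k * gap k) =
      ev g (rk j) * ev h (r z) - ev g (r z) * ev h (rk j).
    rewrite rz !ev_sum mulr_suml mulr_sumr -sumrB [RHS](bigD1 j) //=.
    rewrite -/(rk j) !evZ [X in _ = X + _](_ : _ = 0) ?add0r; last by ring.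
    by apply: eq_bigr => k _; rewrite -/(rk k) /gap !evZ; ring.
  by rewrite subr_le0.
have /eqP : \sum_(k | k != j) - (t k * gap k) = 0.
  apply/eqP; rewrite eq_le sle /=; apply: sumr_ge0 => k kj.
  by rewrite oppr_ge0 mulr_ge0_le0 // ltW // term.
rewrite psumr_eq0 => [/allP all0|k kj]; last first.
  by rewrite oppr_ge0 mulr_ge0_le0 // ltW // term.
have tk k : k != j -> t k = 0.
  move=> kj; have := all0 k (mem_index_enum k); rewrite kj /= oppr_eq0 mulf_eq0.
  by rewrite (lt_eqF (term k kj)) orbF => /eqP.
have [c [cj cP]] := nb_edge_functional j.
have := cP z zu zj; rewrite rz ev_sum big1 ?ltxx // => k _.
by have [->|/tk ->] := eqVneq k j; rewrite evZ ?mul0r // -/(rk j) cj mulr0.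
Qed.

Lemma sum_pattern (V : nmodType) (F : 'I_4 -> V) j1 j2 j3 j4 :
  uniq [:: j1; j2; j3; j4] -> \sum_k F k = F j1 + F j2 + (F j3 + F j4).
Proof.
by move=> us; rewrite (sum_ord4 _ us) // !big_cons big_nil addr0 addrA.
Qed.

(** The diagonal through [j3] and [j4] of the quadrilateral seen from [u] has [j1]
    and [j2] on different sides.  It does not contain [j1], because a nontrivial
    dependence involves all four directions. *)
Lemma diagonal_functional (m : 'I_4 -> R) j1 j2 j3 j4 :
  \sum_k m k *: rk k = 0 -> uniq [:: j1; j2; j3; j4] ->
  0 < m j1 * m j2 -> exists c, [/\ ev c (rk j3) = 0, ev c (rk j4) = 0,
    0 < ev c (rk j1) & ev c (rk j2) < 0].
Proof.
move=> mr us m12.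
have [|sub] := boolP (rk j1 <= rk j3 + rk j4)%MS.
  move=> /sub_addsmxP[[A B] /= E]; exfalso.
  pose m' k := if k == j1 then 1 else if k == j3 then - A 0 0
               else if k == j4 then - B 0 0 else 0.
  move: (us); rewrite /= !inE !negb_or.
  move=> /and4P[/and3P[n12 n13 n14] /andP[n23 n24] n34 _].
  have m'r : \sum_k m' k *: rk k = 0.
    rewrite (sum_pattern _ us) /m' !eqxx (eq_sym j3) (negPf n13).
    rewrite (eq_sym j4 j1) (negPf n14) (eq_sym j4 j3) (negPf n34).
    rewrite (eq_sym j2 j1) (negPf n12) (negPf n23) (negPf n24) scale1r scale0r.
    rewrite addr0 E (mx11_scalar A) (mx11_scalar B) !mul_scalar_mx !mxE !mulr1n.
    by rewrite !scaleNr -opprD subrr.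
  have [|k1 [k2 [k3 [k4 [ks [p1 p2 p3 p4]]]]]] := dependence_pattern m'r.
    by exists j1; rewrite /m' eqxx oner_neq0.
  have := mem_ord4 j2 ks erefl; rewrite !inE.
  have m'2 : m' j2 = 0.
    by rewrite /m' (eq_sym j2 j1) (negPf n12) (negPf n23) (negPf n24).
  by move=> /or4P[] /eqP E2; move: p1 p2 p3 p4; rewrite -E2 m'2 ltxx.
rewrite submxE in sub; have /rV0Pn[i ci] := sub.
pose M := cokermx (rk j3 + rk j4)%MS; pose c0 := col i M.
have c0E v : ev c0 v = (v *m M) 0 i by rewrite /ev /c0 colE mulmxA -colE mxE.
have kill v : (v <= rk j3 + rk j4)%MS -> ev c0 v = 0.
  by rewrite submxE c0E => /eqP ->; rewrite mxE.
pose c : 'cV[R]_d := ev c0 (rk j1) *: c0.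
have c1 : 0 < ev c (rk j1).
  by rewrite evZl -expr2 exprn_even_gt0 //= c0E.
have c3 : ev c (rk j3) = 0 by rewrite evZl (kill (rk j3)) ?mulr0 // addsmxSl.
have c4 : ev c (rk j4) = 0 by rewrite evZl (kill (rk j4)) ?mulr0 // addsmxSr.
exists c; split=> //.
have := congr1 (ev c) mr; rewrite ev0 ev_sum (sum_pattern _ us) !evZ c3 c4.
rewrite !mulr0 !addr0 => E.
rewrite ltNge; apply/negP => c2.
have m1 : m j1 != 0 by apply: contraTneq m12 => ->; rewrite mul0r ltxx.
have t1 : 0 < m j1 * m j1 by rewrite -expr2 exprn_even_gt0.
have t2 : 0 < (m j1 * m j1) * ev c (rk j1) by rewrite mulr_gt0.
have t3 := mulr_ge0 (ltW m12) c2.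
have t4 : m j1 * (m j1 * ev c (rk j1) + m j2 * ev c (rk j2)) = 0.
  by rewrite E mulr0.
clear mr; lra.
Qed.

(** The height and the two diagonal functionals are coordinates on the span of
    the edge directions. *)
Lemma diagonal_coordinates h f1 g1 (m : 'I_4 -> R) j1 j2 j3 j4 y :
  (forall z, z != u -> 0 < ev h (r z)) ->
  \sum_k m k *: rk k = 0 -> uniq [:: j1; j2; j3; j4] ->
  0 < m j1 -> 0 < m j2 -> m j3 < 0 ->
  ev f1 (rk j3) = 0 -> ev f1 (rk j4) = 0 -> ev f1 (rk j2) < 0 ->
  ev g1 (rk j1) = 0 -> ev g1 (rk j2) = 0 -> ev g1 (rk j4) < 0 ->
  (y <= edge_mx f nb u)%MS -> ev f1 y = 0 -> ev g1 y = 0 -> ev h y = 0 -> y = 0.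
Proof.
move=> hP mr us m1 m2 m3 f3 f4 f2n g1z g2z g4n /submxP[D yE] fy gy hy.
have hk k : 0 < ev h (rk k) by apply: hP; apply: nb_neq.
pose t k := D 0 k.
have {}yE : y = \sum_k t k *: rk k.
  by rewrite yE mulmx_sum_row; apply: eq_bigr => k _; rewrite rowK.
have ef1 w : ev f1 (\sum_k w k *: rk k) =
    w j1 * ev f1 (rk j1) + w j2 * ev f1 (rk j2).
  by rewrite ev_sum (sum_pattern _ us) !evZ f3 f4 !mulr0 !addr0.
have eg1 w : ev g1 (\sum_k w k *: rk k) =
    w j3 * ev g1 (rk j3) + w j4 * ev g1 (rk j4).
  by rewrite ev_sum (sum_pattern _ us) !evZ g1z g2z !mulr0 !add0r.
have mf := congr1 (ev f1) mr; rewrite ev0 ef1 in mf.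
have mg := congr1 (ev g1) mr; rewrite ev0 eg1 in mg.
rewrite yE ef1 in fy; rewrite yE eg1 in gy.
have [a ta1] : exists a, t j1 = a * m j1.
  by exists (t j1 / m j1); rewrite divfK // gt_eqF.
have [b tb3] : exists b, t j3 = b * m j3.
  by exists (t j3 / m j3); rewrite divfK // lt_eqF.
have ratio (p q q' x x' k : R) : x' < 0 -> p * x + q * x' = 0 ->
    k * p * x + q' * x' = 0 -> q' = k * q.
  move=> x0 E1 E2; apply: (mulIf (ltr0_neq0 x0)).
  have : k * (p * x + q * x') = 0 by rewrite E1 mulr0.
  lra.
rewrite ta1 in fy; have ta2 := ratio _ _ _ _ _ _ f2n mf fy.
rewrite tb3 in gy; have tb4 := ratio _ _ _ _ _ _ g4n mg gy.
have yE2 : y = (a - b) *: (m j1 *: rk j1 + m j2 *: rk j2).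
  rewrite yE (sum_pattern _ us) ta1 ta2 tb3 tb4 -!scalerA -!scalerDr.
  have -> : m j3 *: rk j3 + m j4 *: rk j4 = - (m j1 *: rk j1 + m j2 *: rk j2).
    by move/eqP: mr; rewrite (sum_pattern _ us) addrC addr_eq0 => /eqP.
  by rewrite scalerN scalerBl.
move: hy; rewrite yE2 evZ evD !evZ => /eqP; rewrite mulf_eq0 => /orP[/eqP->|].
  by rewrite scale0r.
by rewrite gt_eqF // addr_gt0 // mulr_gt0.
Qed.

Definition path_avoiding (p : nat -> T) k a b := [/\ p 0 = a, p k = b,
  forall i, (i < k)%N -> e (p i) (p i.+1) & forall i, (i <= k)%N -> p i != u].

(** Central projection from [u] draws the two paths in the plane, with coordinates
    the diagonal functionals divided by the height.  There they meet, on two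
    segments that belong to edges; these edges share a vertex by
    [crossing_segments]. *)
Lemma no_disjoint_paths (m : 'I_4 -> R) j1 j2 j3 j4 p q k l :
  \sum_k m k *: rk k = 0 -> uniq [:: j1; j2; j3; j4] ->
  0 < m j1 -> 0 < m j2 -> m j3 < 0 -> m j4 < 0 ->
  path_avoiding p k (nb u j1) (nb u j2) ->
  path_avoiding q l (nb u j3) (nb u j4) ->
  (forall i j, (i <= k)%N -> (j <= l)%N -> p i != q j) -> False.
Proof.
move=> mr us m1 m2 m3 m4 [p0 pk pe pu] [q0 ql qe qu] pq.
have [h hP] := height.
have [f1 [f3 f4 f1p f2n]] := diagonal_functional mr us (mulr_gt0 m1 m2).
have us' : uniq [:: j3; j4; j1; j2] by rewrite (uniq_catC [:: j3; j4]).
have m34 : 0 < m j3 * m j4 by rewrite nmulr_lgt0.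
have [g1 [g1z g2z g3p g4n]] := diagonal_functional mr us' m34.
pose proj z := (ev f1 (r z) / ev h (r z), ev g1 (r z) / ev h (r z)).
pose A i := proj (p i); pose B j := proj (q j).
have mem4 i : [\/ i = j1, i = j2, i = j3 | i = j4].
  by have := mem_ord4 i us erefl; rewrite !inE => /or4P[] /eqP->;
    [apply: Or41|apply: Or42|apply: Or43|apply: Or44].
have g_le i : i != j3 -> ev g1 (rk i) <= 0.
  by case: (mem4 i) => ->; rewrite ?eqxx ?g1z ?g2z // => _; apply: ltW.
have Ng_le i : i != j4 -> ev (- g1) (rk i) <= 0.
  case: (mem4 i) => ->; rewrite ?eqxx // evNl ?g1z ?g2z ?oppr0 // => _.
  by rewrite oppr_le0 ltW.
have f_le i : i != j1 -> ev f1 (rk i) <= 0.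
  by case: (mem4 i) => ->; rewrite ?eqxx ?f3 ?f4 // => _; apply: ltW.
have Nf_le i : i != j2 -> ev (- f1) (rk i) <= 0.
  case: (mem4 i) => ->; rewrite ?eqxx // evNl ?f3 ?f4 ?oppr0 // => _.
  by rewrite oppr_le0 ltW.
have [i ik|j jl|i [j [s [t [v [w [/andP[ik jl] ws st stvw [E1 E2]]]]]]]] :=
    @plane_paths_meet _ A B k l.
- rewrite /A /B /proj q0 ql /=; apply/andP; split.
    have := @extreme_slope h (- g1) j4 (p i) hP.
    rewrite !evNl !mulNr ltrN2 oppr_gt0.
    by apply => //; [exact: pu | rewrite -ql; exact: pq].
  apply: (@extreme_slope h g1 j3 (p i) hP) => //; first exact: pu.
  by rewrite -q0; apply: pq.
- rewrite /A /B /proj p0 pk /=; apply/andP; split.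
    have := @extreme_slope h (- f1) j2 (q j) hP.
    rewrite !evNl !mulNr ltrN2 oppr_gt0.
    by apply => //; [exact: qu | rewrite -pk eq_sym; exact: pq].
  apply: (@extreme_slope h f1 j1 (q j) hP) => //; first exact: qu.
  by rewrite -p0 eq_sym; apply: pq.
have [s0 t0 v0 w0] := ws.
have [piu pi1u] := (pu i (ltnW ik), pu i.+1 ik).
have [qju qj1u] := (qu j (ltnW jl), qu j.+1 jl).
have [ha hb] := (hP _ piu, hP _ pi1u); have [hc hd] := (hP _ qju, hP _ qj1u).
pose s' := s / ev h (r (p i)); pose t' := t / ev h (r (p i.+1)).
pose v' := v / ev h (r (q j)); pose w' := w / ev h (r (q j.+1)).
pose y := s' *: r (p i) + t' *: r (p i.+1)
  - (v' *: r (q j) + w' *: r (q j.+1)).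
have yE c : ev c y = s' * ev c (r (p i)) + t' * ev c (r (p i.+1))
    - (v' * ev c (r (q j)) + w' * ev c (r (q j.+1))).
  by rewrite /y [LHS]evB (evD _ (_ *: r (p i))) (evD _ (_ *: r (q j))) !evZ.
have y0 : y = 0.
  apply: (diagonal_coordinates hP mr us m1 m2 m3 f3 f4 f2n g1z g2z g4n).
  - by rewrite addmx_sub ?eqmx_opp ?addmx_sub // scalemx_sub //
      (nb_cone_sub ef enb).
  - rewrite yE; move: E1; rewrite /= !mulrA ![_ / _ * _]mulrAC => ->.
    by rewrite subrr.
  - rewrite yE; move: E2; rewrite /= !mulrA ![_ / _ * _]mulrAC => ->.
    by rewrite subrr.
  by rewrite yE !divfK ?gt_eqF // stvw subrr.
have {y0} yy : s' *: r (p i) + t' *: r (p i.+1) =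
    v' *: r (q j) + w' *: r (q j.+1).
  by apply/eqP; rewrite -subr_eq0; apply/eqP.
have pos (x z : R) : 0 <= x -> 0 < z -> 0 <= x / z.
  by move=> x0 z0; rewrite divr_ge0 // ltW.
have [pij pij1 pi1j pi1j1] :
    [/\ p i != q j, p i != q j.+1, p i.+1 != q j & p i.+1 != q j.+1].
  by split; apply: pq => //; apply: ltnW.
have zero x z x' z' : 0 < z -> 0 < z' -> 0 <= x -> 0 <= x' ->
    x / z + x' / z' = 0 -> x + x' = 0 :> R.
  move=> z0 z'0 x0 x'0 /eqP; rewrite paddr_eq0; [|exact: pos..].
  rewrite !mulf_eq0 !invr_eq0 (gt_eqF z0) (gt_eqF z'0) !orbF.
  by move=> /andP[/eqP-> /eqP->]; rewrite addr0.
have [le|lt] := leP (v' + w') (s' + t').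
  have := @crossing_segments h _ _ (q j) (q j.+1) _ _ _ _ hP
    (pe i ik) piu pi1u _ _ (pos _ _ s0 ha) (pos _ _ t0 hb)
    (pos _ _ v0 hc) (pos _ _ w0 hd) le yy.
  rewrite !inE !negb_or ![q _ == _]eq_sym pij pij1 pi1j pi1j1 => /(_ isT isT).
  by move/(zero _ _ _ _ ha hb s0 t0) => E; rewrite E ltxx in st.
have := @crossing_segments h _ _ (p i) (p i.+1) _ _ _ _ hP
  (qe j jl) qju qj1u _ _ (pos _ _ v0 hc) (pos _ _ w0 hd)
  (pos _ _ s0 ha) (pos _ _ t0 hb) (ltW lt) (esym yy).
rewrite !inE !negb_or pij pij1 pi1j pi1j1 => /(_ isT isT).
by move/(zero _ _ _ _ hc hd v0 w0) => E; rewrite stvw E ltxx in st.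
Qed.

End NonSimpleVertex.
(** * The graphs [G n] *)

#[local] Arguments G : simpl never.

Section TheGraph.
Variable n : nat.
Hypothesis n1 : (1 <= n)%N.
Notation T := (G_vertex n).
Notation Zm := 'Z_(n.*2.+3).
Implicit Types x : Zm.

Lemma natZ_neq0 k : (0 < k < n.*2.+3)%N -> (k%:R : Zm) != 0.
Proof.
move=> /andP[k0 km]; apply/eqP => /(congr1 val) /=.
by rewrite val_Zp_nat // modn_small // => E; rewrite E in k0.
Qed.

Lemma natZ_modulus : (n.*2.+3%:R : Zm) = 0.
Proof. exact: pchar_Zp. Qed.

Lemma natZ_pred : (n.*2.+2%:R : Zm) = -1.
Proof. by apply/eqP; rewrite -addr_eq0 -mulrSr natZ_modulus. Qed.

Definition nb (a : T) (k : 'I_4) : T :=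
  let y' : Zm := (a.2 : nat)%:R in
  nth a [:: (a.1 + y' + 1, a.2); (a.1 + y', a.2 + 1);
            (a.1 - y' - 1, a.2); (a.1 + y' - 1, a.2 + 1)] k.

Lemma G_nb a b : G n a b <-> exists k, b = nb a k.
Proof.
case: a => x y; split=> [|[k ->]]; last by rewrite /G /nb mem_nth.
by move=> /(nthP (x, y))[k k4 <-]; exists (Ordinal k4).
Qed.

Let o0 : 'I_4 := @Ordinal 4 0 isT.
Let o1 : 'I_4 := @Ordinal 4 1 isT.
Let o2 : 'I_4 := @Ordinal 4 2 isT.
Let o3 : 'I_4 := @Ordinal 4 3 isT.

Lemma Z2D1 : (1 + 1 : 'Z_2) = 0. Proof. exact: val_inj. Qed.

Lemma nb0E x : [/\ nb (x, 0) o0 = (x + 1, 0), nb (x, 0) o1 = (x, 1),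
  nb (x, 0) o2 = (x - 1, 0) & nb (x, 0) o3 = (x - 1, 1)].
Proof. by rewrite /nb /= !addr0 subr0 !add0r. Qed.

Lemma nb1E x : [/\ nb (x, 1) o0 = (x + 1 + 1, 1), nb (x, 1) o1 = (x + 1, 0),
  nb (x, 1) o2 = (x - 1 - 1, 1) & nb (x, 1) o3 = (x, 0)].
Proof. by rewrite /nb /= Z2D1 addrK. Qed.

Lemma Z2_cases (y : 'Z_2) : y = 0 \/ y = 1.
Proof. by case: y => [[|[|//]] i]; [left|right]; apply: val_inj. Qed.

Lemma one_neq0 : (1 : Zm) != 0. Proof. exact: (@natZ_neq0 1). Qed.

Lemma two_neq0 : (1 + 1 : Zm) != 0.
Proof. by rewrite -(natrD _ 1 1) natZ_neq0. Qed.

Lemma three_neq0 : (1 + 1 + 1 : Zm) != 0.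
Proof.
by rewrite -!addrA; apply: (@natZ_neq0 3); rewrite /= !ltnS double_gt0.
Qed.

Lemma four_neq0 : (1 + 1 + 1 + 1 : Zm) != 0.
Proof.
by rewrite -!addrA; apply: (@natZ_neq0 4); rewrite /= !ltnS (leq_double 1).
Qed.

Lemma Z2_01 : ((0 : 'Z_2) == 1 = false) * ((1 : 'Z_2) == 0 = false).
Proof. by []. Qed.

Lemma neq_by (a b c : Zm) : c != 0 -> a - b = c -> (a == b) = false.
Proof. by move=> c0 E; apply/negbTE; rewrite -subr_eq0 E. Qed.

Lemma nb_inj a : injective (nb a).
Proof.
move=> k l kl; apply/val_inj/eqP; move: kl.
case: a => [x0 y]; pose x : Zm := x0; rewrite -[x0]/x; clearbody x => {x0}.
rewrite /nb => /eqP; rewrite (nth_uniq (x, y)) ?ltn_ord //=.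
have [->|->] := Z2_cases y; rewrite ?addr0 ?subr0 ?add0r ?Z2D1 ?addrK !inE.
  rewrite !xpair_eqE !Z2_01 !eqxx !andbT !andbF !orbF /=.
  have -> : (x + 1 == x - 1) = false by apply: (neq_by two_neq0); ring.
  by have -> : (x == x - 1) = false by apply: (neq_by one_neq0); ring.
rewrite !xpair_eqE !Z2_01 !eqxx !andbT !andbF !orbF /=.
have -> : (x + 1 + 1 == x - 1 - 1) = false by apply: (neq_by four_neq0); ring.
by have -> : (x + 1 == x) = false by apply: (neq_by one_neq0); ring.
Qed.

Section Realization.
Variables (R : realType) (d : nat) (f : T -> 'rV[R]_d).
Hypothesis ef : graph_config (G n) f.

Let u : T := (0, 0).

Lemma nb_o0 x : nb (x, 0) o0 = (x + 1, 0). Proof. by have [] := nb0E x. Qed.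
Lemma nb_o1 x : nb (x, 0) o1 = (x, 1). Proof. by have [] := nb0E x. Qed.
Lemma nb_o2 x : nb (x, 0) o2 = (x - 1, 0). Proof. by have [] := nb0E x. Qed.
Lemma nb_o3 x : nb (x, 0) o3 = (x - 1, 1). Proof. by have [] := nb0E x. Qed.

Lemma edge00 x y : y = x + 1 -> G n (x, 0) (y, 0).
Proof. by move=> ->; apply/G_nb; exists o0; rewrite nb_o0. Qed.

Lemma edge01 x : G n (x, 0) (x, 1).
Proof. by apply/G_nb; exists o1; rewrite nb_o1. Qed.

Lemma edge01_pred x y : y = x - 1 -> G n (x, 0) (y, 1).
Proof. by move=> ->; apply/G_nb; exists o3; rewrite nb_o3. Qed.

Lemma edge10 x y : y = x + 1 -> G n (x, 1) (y, 0).
Proof. by move=> ->; apply/G_nb; exists o1; have [_ -> _ _] := nb1E x. Qed.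

Lemma edge11_succ x y : y = x + 1 + 1 -> G n (x, 1) (y, 1).
Proof. by move=> ->; apply/G_nb; exists o0; have [-> _ _ _] := nb1E x. Qed.

Lemma edge11_pred x y : y = x - 1 - 1 -> G n (x, 1) (y, 1).
Proof. by move=> ->; apply/G_nb; exists o2; have [_ _ -> _] := nb1E x. Qed.

(** In the quadrilateral seen from the origin, [j1] and [j2] are opposite corners,
    and so are [j3] and [j4]. *)
Definition crossing_at (m : 'I_4 -> R) (j1 j2 j3 j4 : 'I_4) :=
  [/\ \sum_k m k *: (f (nb u k) - f u) = 0,
      0 < m j1, 0 < m j2, m j3 < 0 & m j4 < 0].

Lemma no_crossing m (j1 j2 j3 j4 : 'I_4) (p q : nat -> T) k l :
  crossing_at m j1 j2 j3 j4 -> uniq [:: j1; j2; j3; j4] ->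
  path_avoiding (G n) u p k (nb u j1) (nb u j2) ->
  path_avoiding (G n) u q l (nb u j3) (nb u j4) ->
  (forall i j, (i <= k)%N -> (j <= l)%N -> p i != q j) -> False.
Proof.
move=> [mr m1 m2 m3 m4] us pp qq pq.
exact: (no_disjoint_paths ef G_nb nb_inj mr us m1 m2 m3 m4 pp qq pq).
Qed.

Lemma no_triangle_crossing m : ~ crossing_at m o0 o1 o2 o3.
Proof.
move=> mX; have n1' := one_neq0.
apply: (@no_crossing m o0 o1 o2 o3 (nth u [:: (1, 0); (0, 1)])
  (nth u [:: (-1, 0); (-1, 1)]) 1 1 mX erefl).
- split=> [||[|//] _|[|[|//]] _] //=; rewrite ?nb_o0 ?nb_o1 ?add0r //.
  by apply: edge01_pred; rewrite subrr.
- split=> [||[|//] _|[|[|//]] _] //=; rewrite ?nb_o2 ?nb_o3 ?add0r //.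
  + exact: edge01.
  + by rewrite xpair_eqE oppr_eq0 (negPf n1').
  by rewrite xpair_eqE andbF.
move=> [|[|//]] [|[|//]] _ _ /=; rewrite ?xpair_eqE ?eqxx ?andbT ?andbF //.
  by have -> : (1 == -1 :> Zm) = false by apply: (neq_by two_neq0); ring.
by have -> : (0 == -1 :> Zm) = false by apply: (neq_by one_neq0); ring.
Qed.

Lemma no_square_crossing m : ~ crossing_at m o0 o3 o1 o2.
Proof.
move=> mX; have n1' := one_neq0.
apply: (@no_crossing m o0 o3 o1 o2 (nth u [:: (1, 0); (1, 1); (-1, 1)])
  (nth u [:: (0, 1); (- (1 + 1), 1); (-1, 0)]) 2 2 mX erefl).
- split=> [||[|[|//]] _|[|[|[|//]]] _] //=; rewrite ?nb_o0 ?nb_o3 ?add0r //.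
  + by apply: edge11_pred; ring.
  by rewrite xpair_eqE andbF.
- split=> [||[|[|//]] _|[|[|[|//]]] _] //=; rewrite ?nb_o1 ?nb_o2 ?add0r //.
  + by apply: edge11_pred; ring.
  + by apply: edge10; ring.
  + by rewrite xpair_eqE andbF.
  by rewrite xpair_eqE oppr_eq0 (negPf n1').
move=> [|[|[|//]]] [|[|[|//]]] _ _ /=;
  rewrite ?xpair_eqE ?eqxx ?andbT ?andbF //.
- by have -> : (1 == -1 :> Zm) = false by apply: (neq_by two_neq0); ring.
- have -> // : (1 == - (1 + 1) :> Zm) = false.
  by apply: (neq_by three_neq0); ring.
- by rewrite oppr_eq0.
by have -> : (-1 == - (1 + 1) :> Zm) = false by apply: (neq_by one_neq0); ring.
Qed.

(** Steps of 2 through the vertices [(x, 1)] lead from [(0, 1)] to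
    [(-1, 1) = (2n+2, 1)]. *)
Lemma no_cycle_crossing m : ~ crossing_at m o0 o2 o1 o3.
Proof.
move=> mX.
apply: (@no_crossing m o0 o2 o1 o3 (fun i => (i.+1%:R, 0))
  (fun j => (j.*2%:R, 1)) n.*2.+1 n.+1 mX erefl).
- split=> [||i ik|i ik]; rewrite ?nb_o0 ?nb_o2 ?add0r ?natZ_pred //.
    by apply: edge00; rewrite -natr1.
  by rewrite xpair_eqE eqxx andbT natZ_neq0 // !ltnS.
- split=> [||i ik|i ik]; rewrite ?nb_o1 ?nb_o3 ?add0r ?doubleS ?natZ_pred //.
    by apply: edge11_succ; rewrite -!natr1.
  by rewrite xpair_eqE andbF.
by move=> i j _ _; rewrite xpair_eqE andbF.
Qed.

Lemma simple_origin : row_free (edge_mx f nb u).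
Proof.
apply: contraT; rewrite -kermx_eq0 => /rowV0Pn[v /sub_kermxP vM v0].
pose m k := v 0 k.
have mr : \sum_k m k *: (f (nb u k) - f u) = 0.
  transitivity (v *m edge_mx f nb u); last exact: vM.
  rewrite mulmx_sum_row; apply: eq_bigr => k _.
  by rewrite (rowK (fun k => f (nb u k) - f u)).
have m0 : exists k, m k != 0 by apply/rV0Pn.
have oc i : [\/ i = o0, i = o1, i = o2 | i = o3].
  by case: i => [[|[|[|[|//]]]] i];
    [apply: Or41|apply: Or42|apply: Or43|apply: Or44]; apply: val_inj.
have key w j a b : uniq [:: o0; j; a; b] -> ~ crossing_at w o0 j a b.
  have swap (i k l : 'I_4) : crossing_at w o0 i k l -> crossing_at w o0 i l k.
    by case.
  case: (oc j) => ->; case: (oc a) => ->; case: (oc b) => -> us;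
    solve [case: (notF us) | exact: no_triangle_crossing
      | exact: no_square_crossing | exact: no_cycle_crossing
      | (move/swap; exact: no_triangle_crossing)
      | (move/swap; exact: no_square_crossing)
      | (move/swap; exact: no_cycle_crossing)].
have [j1 [j2 [j3 [j4 [us [p1 p2 p3 p4]]]]]] :=
  dependence_pattern ef G_nb nb_inj mr m0.
have swap (a b c l : 'I_4) : uniq [:: a; b; c; l] -> uniq [:: b; a; c; l].
  rewrite /= !inE !negb_or (eq_sym b a).
  by move=> /and4P[/and3P[-> -> ->] /andP[-> ->] -> _].
have us' : uniq [:: j3; j4; j1; j2] by rewrite (uniq_catC [:: j3; j4]).
have Nmr : \sum_k (- m k) *: (f (nb u k) - f u) = 0.
  by under eq_bigr do rewrite scaleNr; rewrite sumrN mr oppr0.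
have := mem_ord4 o0 us erefl; rewrite !inE => /or4P[] /eqP E; exfalso.
- by apply: (key m j2 j3 j4); rewrite E.
- by apply: (key m j1 j3 j4); rewrite E //; apply: swap.
- by apply: (key (fun k => - m k) j4 j1 j2); rewrite E //; split=> //;
    rewrite ?oppr_gt0 ?oppr_lt0.
by apply: (key (fun k => - m k) j3 j1 j2); rewrite E; [apply: swap|split=> //;
    rewrite ?oppr_gt0 ?oppr_lt0].
Qed.

Lemma not_edge x : ~ G n (x, 0) (x + 1, 1).
Proof.
rewrite /G /= !addr0 subr0 !add0r !inE !xpair_eqE !Z2_01.
rewrite !andbF !eqxx !andbT !orFb.
have -> : (x + 1 == x) = false by apply: (neq_by one_neq0); ring.
by have -> : (x + 1 == x - 1) = false by apply: (neq_by two_neq0); ring.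
Qed.

(** The functional [c] exposes the facet that contains the origin and all its
    neighbours except [(-1, 1)]; [top] is membership of a vertex in it. *)
Section Facet.
Variable c : 'cV[R]_d.
Hypothesis c0 : forall k, ev c (f (nb u k) - f u) = - (k == o3)%:R.
Let top z := ev c (f z) == ev c (f u).

Lemma facet_le z : ev c (f z) <= ev c (f u).
Proof.
have [t [t0 fz]] := nb_cone ef G_nb u z.
rewrite -subr_le0 -evB fz ev_sum; apply: sumr_le0 => k _.
by rewrite evZ c0 mulr_ge0_le0 // oppr_le0 ler0n.
Qed.

Lemma facet_lt z : ~~ top z -> ev c (f z) < ev c (f u).
Proof. by move=> zt; rewrite lt_neqAle zt facet_le. Qed.

Lemma facet_top k : top (nb u k) = (k != o3).
Proof. by rewrite /top -subr_eq0 -evB c0 oppr_eq0 pnatr_eq0 eqb0. Qed.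

Lemma facet_other x k l : k != l -> top (x, 0) -> ~~ top (nb (x, 0) k) ->
  top (nb (x, 0) l).
Proof.
move=> kl xt kt; apply: contraT => lt.
have ck j : j != o3 -> ev c (f (nb u j)) = ev c (f u).
  by move=> j3; apply/eqP; rewrite -[_ == _]/(top _) facet_top.
by case: (facet_misses_one ef G_nb simple_origin facet_le ck (eqP xt) kl
  (facet_lt kt) (facet_lt lt)).
Qed.

(** The neighbours [(x, 0)] and [(x+1, 1)] of [(x-1, 1)] are not adjacent. *)
Lemma facet_square x : top (x, 0) -> top (x + 1, 1) -> top (x - 1, 1).
Proof.
move=> xt xt1; apply: contraT => wt; exfalso; apply: (@not_edge x).
have [E0 E1 _ _] := nb1E (x - 1); rewrite !subrK in E0 E1.
rewrite -E0 -E1; apply: (simple_chord ef G_nb (c := c)).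
- exact: (simple_everywhere ef G_nb _ simple_origin).
- by rewrite (inj_eq (@nb_inj _)).
- by move=> z; rewrite E1 (eqP xt) facet_le.
- by rewrite E0 E1 (eqP xt) (eqP xt1).
by rewrite E1 (eqP xt) facet_lt.
Qed.

Definition facet_up x :=
  [/\ top (x, 0), top (x + 1, 0), top (x, 1) & ~~ top (x - 1, 1)].

Definition facet_down x :=
  [/\ top (x, 0), top (x + 1, 0), ~~ top (x, 1) & top (x - 1, 1)].

Lemma facet_up_down x : facet_up x -> facet_down (x + 1).
Proof.
move=> [t0 t1 t2 t3].
have t4 : ~~ top (x + 1, 1) by apply: contraNN t3; apply: facet_square.
split; rewrite ?addrK // -nb_o0; apply: (@facet_other _ o1) => //.
by rewrite nb_o1.
Qed.

Lemma facet_down_up x : facet_down x -> facet_up (x + 1).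
Proof.
move=> [t0 t1 t2 t3]; split; rewrite ?addrK //.
  by rewrite -nb_o0; apply: (@facet_other _ o3) => //; rewrite nb_o3 addrK.
by rewrite -nb_o1; apply: (@facet_other _ o3) => //; rewrite nb_o3 addrK.
Qed.

(** An odd number of steps along the cycle of the [(x, 0)] turns [facet_up 0] into
    [facet_down 0]. *)
Lemma facet_absurd : False.
Proof.
have up0 : facet_up 0.
  have tk k : k != o3 -> top (nb u k) by rewrite facet_top.
  split; first exact: eqxx.
  - by rewrite -nb_o0 tk.
  - by rewrite -nb_o1 tk.
  by rewrite -nb_o3 facet_top.
have up i : facet_up (i.*2%:R).
  elim: i => [//|i /facet_up_down/facet_down_up].
  by rewrite doubleS -!natr1.
have [_ _ t _] := up0.
have /facet_up_down[_ _ + _] := up n.+1.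
by rewrite natr1 doubleS natZ_modulus t.
Qed.

End Facet.

Lemma no_realization : False.
Proof.
have [c c0] := simple_dual (fun k => - (k == o3)%:R) simple_origin.
exact: facet_absurd c0.
Qed.

End Realization.
End TheGraph.

Theorem lemma1p18 (R : realType) (n : nat) (hn : (1 <= n)%N) :
  ~ polytopal R (G n).
Proof. by move=> /polytopal_config[d [f]]; apply: no_realization. Qed.
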